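(* Consider a run of the trust-region algorithm described in the context, with its stopping test ignored, and with $\nu_k=\alpha\Delta_k/(1+\|B_k\|(1+\alpha\Delta_k))$ at every iteration. Assume that: (i) there is $\kappa_{\mathrm{mdc}}\in(0,1)$ such that $m(0;x_k,B_k)-m(s_k;x_k,B_k)\ge\kappa_{\mathrm{mdc}}\,\xi_{\mathrm{cp}}(\Delta_k;x_k,\nu_k)$ for all $k$; (ii) there is $\kappa_{\mathrm{ubd}}>0$ such that $|(f+h)(x_k+s_k)-m(s_k;x_k,B_k)|\le\kappa_{\mathrm{ubd}}(1+\|B_k\|)\|s_k\|^2$ for all $k$; (iii) there are $\mu>0$ and $0<p<1$ such that $\max_{0\le j\le k}\|B_j\|\le\mu(1+\sigma_k^p)$ for all $k\in\mathbb N$; (iv) infinitely many iterations are successful, and $\mu+1\le\mu|S(\epsilon)|^p$ for all sufficiently small $\epsilon\in(0,1)$; (v) $(f+h)(x_k)$ is bounded below over $k\in\mathbb N$. Let $N\subseteq\mathbb N$ be an infinite index set such that $\{\nu_k^{-1/2}\xi_{\mathrm{cp}}(\Delta_k;x_k,\nu_k)^{1/2}\}_{k\in N}\to0$, $\{\nu_k^{-1}s_{k,1}\}_{k\in N}\to0$, $\{s_{k,1}\}_{k\in N}\to0$ and $\{s_k\}_{k\in N}\to0$, and assume that $\{x_k\}_{k\in N}\to\bar x$ $(\in[\ell,u])$. Assume that there is a model $\psi(\cdot;\bar x)$, proper lsc with $\psi(0;\bar x)=h(\bar x)$ and $\partial\psi(0;\bar x)\subseteq\partial h(\bar x)$, such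 that $$\limsup_{k\in N}\ \partial\widehat\psi(s_{k,1};x_k)\subseteq\partial\widehat\psi(0;\bar x),\qquad\widehat\psi(s;x):=\psi(s;x)+\chi(x+s\mid[\ell,u]),$$ where $\partial$ is taken with respect to $s$. Assume further that the constraint qualification is satisfied at $s=0$ for $$\min_s\ m_{\mathrm{cp}}(s;\bar x,\bar\nu)+\chi(\bar x+s\mid[\ell,u])$$ for some $\bar\nu>0$, and that it is satisfied at $\bar x$ for the problem (P) of minimizing $f+h$ over $[\ell,u]$. Then $\bar x$ is first-order stationary for (P).
   Context: Norms and notation: $\|\cdot\|$ is the Euclidean norm on $\mathbb R^n$ and the induced spectral norm on matrices; $\mathbb B$ is the closed Euclidean unit ball; $\overline{\mathbb R}=\mathbb R\cup\{\pm\infty\}$; $\chi(x\mid A)=0$ if $x\in A$ and $+\infty$ otherwise. For sets $A_k\subseteq\mathbb R^n$, $\limsup_{k\in N}A_k$ is the set of limits of all convergent subsequences $\{y_k\}_{k\in K}$ with $K\subseteq N$ infinite and $y_k\in A_k$ for all $k\in K$. Problem (P): minimize $f(x)+h(x)$ over $x\in\mathbb R^n$ subject to $\ell\le x\le u$, where $\ell\in(\mathbb R\cup\{-\infty\})^n$, $u\in(\mathbb R\cup\{+\infty\})^n$, $\ell\le u$, $f:\mathbb R^n\to\mathbb R$ is continuously differentiable on an open set containing $[\ell,u]$, and $h:\mathbb R^n\to\mathbb R\cup\{+\infty\}$ is proper and lower semicontinuous (lsc). Both may be nonconvex. Subdifferentials: for $\phi:\mathbb R^n\to\overline{\mathbb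 R}$ finite at $\bar x$, $\widehat\partial\phi(\bar x)$ is the set of $v$ with $\liminf_{x\to\bar x,x\ne\bar x}\frac{\phi(x)-\phi(\bar x)-v^T(x-\bar x)}{\|x-\bar x\|}\ge0$; $\partial\phi(\bar x)$ is the set of $v$ for which there are $x_k\to\bar x$, $v_k\to v$ with $\phi(x_k)\to\phi(\bar x)$ and $v_k\in\widehat\partial\phi(x_k)$; $\partial^\infty\phi(\bar x)$ is the set of $v$ for which there are $x_k\to\bar x$, $\lambda_k\downarrow0$ and $v_k\in\widehat\partial\phi(x_k)$ with $\phi(x_k)\to\phi(\bar x)$ and $\lambda_kv_k\to v$. The normal cone is $N_C(\bar x)=\partial\chi(\cdot\mid C)(\bar x)$. The constraint qualification (CQ) holds at $\bar x\in C$ for minimizing $\phi$ over closed $C$ if $\partial^\infty\phi(\bar x)\cap(-N_C(\bar x))=\{0\}$ (for (P): $\phi=f+h$, $C=[\ell,u]$; for a problem with term $\chi(\bar x+s\mid[\ell,u])$: $C=\{s\mid\bar x+s\in[\ell,u]\}$). $\bar x$ is (first-order) stationary for (P) if $0\in\nabla f(\bar x)+\partial h(\bar x)+N_{[\ell,u]}(\bar x)$. Models: for every $x$ where $h$ is finite, a model $\psi(\cdot;x):\mathbb R^n\to\overline{\mathbb R}$ of $s\mapsto h(x+s)$ is given; it is assumed proper lsc with $\psi(0;x)=h(x)$ and $\partial\psi(0;x)\subseteq\partial h(x)$. Set $\varphi_{\mathrm{cp}}(s;x)=f(x)+\nabla f(x)^Ts$, $m_{\mathrm{cp}}(s;x,\nu)=\varphi_{\mathrm{cp}}(s;x)+\tfrac12\nu^{-1}\|s\|^2+\psi(s;x)$,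 and $m(s;x,B)=f(x)+\nabla f(x)^Ts+\tfrac12s^TBs+\psi(s;x)$ with $B=B^T$. Algorithm: constants $0<\eta_1\le\eta_2<1$, $0<1/\gamma_3\le\gamma_1\le\gamma_2<1<\gamma_3\le\gamma_4$, $\Delta_{\max}>\Delta_0>0$, $\alpha>0$, $\beta\ge1$, tolerance $\epsilon>0$, and $x_0\in[\ell,u]$ with $h(x_0)$ finite. At iteration $k=0,1,\dots$, with a symmetric matrix $B_k$: (1) choose $0<\nu_k\le\frac{\alpha\Delta_k}{1+\|B_k\|(1+\alpha\Delta_k)}$; (2) compute $s_{k,1}\in\operatorname{argmin}_s\,m_{\mathrm{cp}}(s;x_k,\nu_k)+\chi(x_k+s\mid[\ell,u]\cap(x_k+\Delta_k\mathbb B))$ and let $\xi_{\mathrm{cp}}(\Delta_k;x_k,\nu_k)=f(x_k)+h(x_k)-\varphi_{\mathrm{cp}}(s_{k,1};x_k)-\psi(s_{k,1};x_k)$; (3) stopping test: terminate if $\nu_k^{-1/2}\xi_{\mathrm{cp}}(\Delta_k;x_k,\nu_k)^{1/2}\le\epsilon$; (4) compute an approximate minimizer $s_k$ of $m(\cdot;x_k,B_k)$ subject to $x_k+s\in[\ell,u]$, $\|s\|\le\min(\Delta_k,\beta\|s_{k,1}\|)$, meaning a feasible $s_k$ with $m(s_k;x_k,B_k)\le m(s_{k,1};x_k,B_k)$; (5) compute $\rho_k=\frac{(f+h)(x_k)-(f+h)(x_k+s_k)}{m(0;x_k,B_k)-m(s_k;x_k,B_k)}$; set $x_{k+1}=x_k+s_k$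 if $\rho_k\ge\eta_1$ and $x_{k+1}=x_k$ otherwise; (6) choose $\bar\Delta_{k+1}\in[\gamma_3\Delta_k,\gamma_4\Delta_k]$ if $\rho_k\ge\eta_2$ (very successful), in $[\gamma_2\Delta_k,\Delta_k]$ if $\eta_1\le\rho_k<\eta_2$, in $[\gamma_1\Delta_k,\gamma_2\Delta_k]$ if $\rho_k<\eta_1$ (unsuccessful); set $\Delta_{k+1}=\min(\bar\Delta_{k+1},\Delta_{\max})$. Iteration $k$ is successful if $\rho_k\ge\eta_1$. $\sigma_k=|\{j=0,\dots,k\mid\rho_j\ge\eta_1\}|$. For $0<\epsilon<1$, $k_\epsilon$ is the first iteration with $\nu_k^{-1/2}\xi_{\mathrm{cp}}(\Delta_k;x_k,\nu_k)^{1/2}\le\epsilon$ ($k_\epsilon=\infty$ if there is none), and $S(\epsilon)=\{k=0,\dots,k_\epsilon-1\mid\rho_k\ge\eta_1\}$. *)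

(* Defs.v *)
From HB Require Import structures.
From mathcomp Require Import all_boot all_order all_algebra.
From mathcomp Require Import all_classical all_reals all_analysis.

Set Implicit Arguments.
Unset Strict Implicit.
Unset Printing Implicit Defensive.

Import Order.TTheory GRing.Theory Num.Theory.
Import numFieldNormedType.Exports.

Local Open Scope classical_set_scope.
Local Open Scope ring_scope.

(* Points of R^n are row vectors 'rV[R]_n. The norm `|x| that the library puts
   on 'rV[R]_n is the sup norm; it induces the same topology as the Euclidean
   norm enorm, and the same notion of differentiability, but every quantitative
   use of a norm below is enorm (or the induced matrix norm specnorm). *)
Section Euclidean.
Context {R : realType} {n : nat}.
Implicit Types (x v s : 'rV[R]_n) (B : 'M[R]_n).

Definition dot x v : R := \sum_i x 0 i * v 0 i.

Definition enorm x : R := Num.sqrt (\sum_i x 0 i ^+ 2).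

(* x *m B^T is the transpose of the column vector B x^T. *)
Definition specnorm B : R := sup [set enorm (x *m B^T) | x in [set x | enorm x <= 1]].

Definition grad (f : 'rV[R]_n -> R) x : 'rV[R]_n :=
  \row_i 'D_(delta_mx 0 i) f x.

Definition cont_diff_on (f : 'rV[R]_n -> R) (U : set 'rV[R]_n) : Prop :=
  forall x, U x -> differentiable f x /\ {for x, continuous (grad f)}.

Definition box (l u : 'rV[\bar R]_n) : set 'rV[R]_n :=
  [set x | forall i, (l 0%R i <= (x 0%R i)%:E <= u 0%R i)%E].

End Euclidean.

Section VariationalAnalysis.
Context {R : realType} {n : nat}.
Implicit Types (phi : 'rV[R]_n -> \bar R) (x v : 'rV[R]_n) (C : set 'rV[R]_n).

Definition proper_fun phi : Prop :=
  (forall x, phi x != -oo%E) /\ (exists x, phi x != +oo%E).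

Definition chi C x : \bar R := if x \in C then 0%E else +oo%E.

Definition argmin phi : set 'rV[R]_n := [set x | forall y, (phi x <= phi y)%E].

(* The three subdifferentials are empty at points where phi is not finite. *)
Definition frechet_subdiff phi x : set 'rV[R]_n :=
  [set v | phi x \is a fin_num /\
    (0 <= limf_einf (fun y => (phi y - phi x - (dot v (y - x))%:E)
                              * ((enorm (y - x))^-1)%:E) x^')%E].

Definition subdiff phi x : set 'rV[R]_n :=
  [set v | phi x \is a fin_num /\
    exists x_ v_ : nat -> 'rV[R]_n,
      [/\ x_ k @[k --> \oo] --> x,
          v_ k @[k --> \oo] --> v,
          phi (x_ k) @[k --> \oo] --> phi x &
          forall k, frechet_subdiff phi (x_ k) (v_ k)]].

Definition horizon_subdiff phi x : set 'rV[R]_n :=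
  [set v | phi x \is a fin_num /\
    exists (x_ v_ : nat -> 'rV[R]_n) (lam_ : nat -> R),
      [/\ x_ k @[k --> \oo] --> x,
          (forall k, 0 < lam_ k) /\ lam_ k @[k --> \oo] --> 0,
          forall k, frechet_subdiff phi (x_ k) (v_ k),
          phi (x_ k) @[k --> \oo] --> phi x &
          lam_ k *: v_ k @[k --> \oo] --> v]].

Definition normal_cone C x : set 'rV[R]_n := subdiff (chi C) x.

Definition constraint_qualification phi C x : Prop :=
  C x /\ horizon_subdiff phi x `&` [set - w | w in normal_cone C x] = [set 0].

Definition limsup_sets (N : set nat) (A : nat -> set 'rV[R]_n) : set 'rV[R]_n :=
  [set v | exists K : set nat, exists y : nat -> 'rV[R]_n,
    [/\ K `<=` N, infinite_set K,
        forall k, K k -> A k (y k) &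
        y k @[k --> within K \oo] --> v]].

Definition stationary (f : 'rV[R]_n -> R) (h : 'rV[R]_n -> \bar R)
    (l u : 'rV[\bar R]_n) x : Prop :=
  exists v w, [/\ subdiff h x v, normal_cone (box l u) x w &
                  0 = grad f x + v + w].

(* psi is a model of s |-> h (x + s). *)
Definition is_model (h : 'rV[R]_n -> \bar R) x (psi : 'rV[R]_n -> \bar R) : Prop :=
  [/\ proper_fun psi, lower_semicontinuous psi, psi 0 = h x &
      subdiff psi 0 `<=` subdiff h x].

End VariationalAnalysis.

Section TrustRegion.
Context {R : realType} {n : nat}.
Implicit Types (f : 'rV[R]_n -> R) (h : 'rV[R]_n -> \bar R).
Implicit Types (l u : 'rV[\bar R]_n) (x s : 'rV[R]_n) (nu : R) (B : 'M[R]_n).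

Definition is_problem f h l u : Prop :=
  [/\ forall i, [/\ l 0 i != +oo%E, u 0 i != -oo%E & (l 0%R i <= u 0%R i)%E],
      exists U, [/\ open U, box l u `<=` U & cont_diff_on f U],
      proper_fun h & lower_semicontinuous h].

Definition objective f h x : \bar R := ((f x)%:E + h x)%E.

Definition varphi_cp f x s : R := f x + dot (grad f x) s.

(* In the next three definitions psi is the model at the base point x. *)
Definition m_cp f (psi : 'rV[R]_n -> \bar R) x nu s : \bar R :=
  ((varphi_cp f x s + 2^-1 * nu^-1 * enorm s ^+ 2)%:E + psi s)%E.

Definition m_quad f (psi : 'rV[R]_n -> \bar R) x B s : \bar R :=
  ((f x + dot (grad f x) s + 2^-1 * (s *m B *m s^T) 0 0)%:E + psi s)%E.

Definition psi_hat (psi : 'rV[R]_n -> \bar R) l u x s : \bar R :=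
  (psi s + chi (box l u) (x + s))%E.

Record tr_constants := TRConstants {
  eta1 : R; eta2 : R;
  gam1 : R; gam2 : R; gam3 : R; gam4 : R;
  Delta_max : R; Delta_init : R;
  alpha : R; beta : R }.

Definition valid_constants (c : tr_constants) : Prop :=
  [/\ 0 < eta1 c <= eta2 c /\ eta2 c < 1,
      0 < 1 / gam3 c <= gam1 c /\ gam1 c <= gam2 c < 1,
      1 < gam3 c <= gam4 c,
      0 < Delta_init c < Delta_max c &
      0 < alpha c /\ 1 <= beta c].

Record tr_iterates := TRIterates {
  x_ : nat -> 'rV[R]_n;
  B_ : nat -> 'M[R]_n;
  Delta_ : nat -> R;
  nu_ : nat -> R;
  s1_ : nat -> 'rV[R]_n;
  s_ : nat -> 'rV[R]_n }.

Section Run.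
Variables (f : 'rV[R]_n -> R) (h : 'rV[R]_n -> \bar R) (l u : 'rV[\bar R]_n).
(* psi x s is the model value psi(s; x). *)
Variable psi : 'rV[R]_n -> 'rV[R]_n -> \bar R.
Variables (c : tr_constants) (it : tr_iterates).
Implicit Type k : nat.

Definition xi_cp k : \bar R :=
  ((f (x_ it k))%:E + h (x_ it k) - (varphi_cp f (x_ it k) (s1_ it k))%:E
   - psi (x_ it k) (s1_ it k))%E.

(* As long as h (x_k) is finite, xi_cp k is finite and nonnegative along a run,
   so that neither fine nor Num.sqrt meets its default value. *)
Definition crit_measure k : R :=
  (Num.sqrt (nu_ it k))^-1 * Num.sqrt (fine (xi_cp k)).

Definition m_ k s : \bar R := m_quad f (psi (x_ it k)) (x_ it k) (B_ it k) s.

(* Extended-real valued since h (x_k + s_k) may be +oo. When s_k = 0 the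
   quotient 0 / 0 is 0 (0^-1 is +oo and 0 * +oo is 0 in \bar R), so that such an
   iteration is unsuccessful. *)
Definition rho k : \bar R :=
  ((objective f h (x_ it k) - objective f h (x_ it k + s_ it k))
   / (m_ k 0%R - m_ k (s_ it k)))%E.

Definition successful k : bool := ((eta1 c)%:E <= rho k)%E.

Definition nu_bound k : R :=
  alpha c * Delta_ it k
  / (1 + specnorm (B_ it k) * (1 + alpha c * Delta_ it k)).

Definition trust_region k : set 'rV[R]_n :=
  box l u `&` [set y | enorm (y - x_ it k) <= Delta_ it k].

Definition cauchy_step k : Prop :=
  argmin (fun s => m_cp f (psi (x_ it k)) (x_ it k) (nu_ it k) s
                   + chi (trust_region k) (x_ it k + s)%R)%E (s1_ it k).

Definition trial_step k : Prop :=
  [/\ box l u (x_ it k + s_ it k),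
      enorm (s_ it k) <= Num.min (Delta_ it k) (beta c * enorm (s1_ it k)) &
      (m_ k (s_ it k) <= m_ k (s1_ it k))%E].

Definition radius_choice k (Dbar : R) : Prop :=
  [/\ ((eta2 c)%:E <= rho k)%E ->
        gam3 c * Delta_ it k <= Dbar <= gam4 c * Delta_ it k,
      ((eta1 c)%:E <= rho k < (eta2 c)%:E)%E ->
        gam2 c * Delta_ it k <= Dbar <= Delta_ it k &
      (rho k < (eta1 c)%:E)%E ->
        gam1 c * Delta_ it k <= Dbar <= gam2 c * Delta_ it k].

(* An infinite run: the stopping test is not performed. *)
Definition tr_run : Prop :=
  [/\ valid_constants c,
      box l u (x_ it 0) /\ h (x_ it 0) \is a fin_num,
      Delta_ it 0 = Delta_init c &
      forall k,
        [/\ (B_ it k)^T = B_ it k,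
            0 < nu_ it k <= nu_bound k,
            cauchy_step k,
            trial_step k &
            x_ it k.+1 = (if successful k then x_ it k + s_ it k else x_ it k)
            /\ exists2 Dbar, radius_choice k Dbar &
                 Delta_ it k.+1 = Num.min Dbar (Delta_max c)]].

Definition num_successful k : nat := #|[set j : 'I_k.+1 | successful j]|%SET.

(* The infimum of a set of iteration indices, in \bar R: the first iteration
   whose measure is at most eps, and +oo if there is none. *)
Definition k_eps (eps : R) : \bar R :=
  ereal_inf [set k%:R%:E | k in [set k | crit_measure k <= eps]].

Definition S_eps (eps : R) : set nat :=
  [set k | (k%:R%:E < k_eps eps)%E /\ successful k].

End Run.
End TrustRegion.

(* Main.v *)
(* Since nu_k <= alpha Delta_k and s_{k,1} / nu_k -> 0 along N, the trust-region
   constraint is eventually inactive at s_{k,1}, so Fermat's rule gives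
     - grad f(x_k) - s_{k,1} / nu_k  in  d psi_hat(s_{k,1}; x_k);
   in the limit, - grad f(xbar) in d psi_hat(0; xbar). The constraint
   qualification then splits this subgradient by the sum rule
     d (phi + chi_C)(x)  included in  d phi(x) + N_C(x).
   The sum rule follows from a fuzzy version for Frechet subgradients, obtained
   by minimising phi(y) + chi_C(z) plus a smooth term and k |y - z|^2: if the
   subgradients of phi so obtained stay bounded, a cluster point does it; if not,
   normalising them gives a nonzero horizon subgradient whose opposite is normal
   to C, which the qualification forbids.
   Limits and balls are taken in the sup norm `|x| of 'rV[R]_n. *)
Require Import Defs.
From HB Require Import structures.
From mathcomp Require Import all_boot all_order all_algebra.
From mathcomp Require Import all_classical all_reals all_analysis.
From mathcomp Require Import ring lra.
Import Order.TTheory GRing.Theory Num.Theory.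
Import numFieldNormedType.Exports.
Local Open Scope classical_set_scope.
Local Open Scope ring_scope.
Set Implicit Arguments.
Unset Strict Implicit.
Unset Printing Implicit Defensive.

(** * Inner product, and comparison of the Euclidean norm with the sup norm *)

Section EuclideanTheory.
Context {R : realType} {n : nat}.
Implicit Types (x y v w : 'rV[R]_n) (a e : R).

Lemma dotC x y : dot x y = dot y x.
Proof. by apply: eq_bigr => i _; rewrite mulrC. Qed.

Lemma dotDr x y w : dot x (y + w) = dot x y + dot x w.
Proof. by rewrite -big_split; apply: eq_bigr => i _; rewrite mxE mulrDr. Qed.

Lemma dotDl x y w : dot (x + y) w = dot x w + dot y w.
Proof. by rewrite ![dot _ w]dotC dotDr. Qed.

Lemma dotZr a x y : dot x (a *: y) = a * dot x y.
Proof. by rewrite mulr_sumr; apply: eq_bigr => i _; rewrite mxE mulrCA. Qed.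

Lemma dotZl a x y : dot (a *: x) y = a * dot x y.
Proof. by rewrite ![dot _ y]dotC dotZr. Qed.

Lemma dotNr x y : dot x (- y) = - dot x y.
Proof. by rewrite -scaleN1r dotZr mulN1r. Qed.

Lemma dotNl x y : dot (- x) y = - dot x y.
Proof. by rewrite ![dot _ y]dotC dotNr. Qed.

Lemma dot0l x : dot 0 x = 0.
Proof. by rewrite -(scale0r x) dotZl mul0r. Qed.

Lemma dot0r x : dot x 0 = 0.
Proof. by rewrite dotC dot0l. Qed.

Definition dotE := (dotDl, dotDr, dotNl, dotNr, dotZl, dotZr).

Lemma coord_le_norm x i : `|x 0 i| <= `|x|.
Proof.
rewrite [leRHS]/Num.norm/= mx_normrE.
exact: (le_bigmax _ (fun ij : 'I_1 * 'I_n => `|x ij.1 ij.2|) (0, i)).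
Qed.

Lemma norm_sqr_le_dot x : `|x| ^+ 2 <= dot x x.
Proof.
have [->|x0] := eqVneq `|x| 0.
  by rewrite expr0n/= sumr_ge0// => i _; rewrite -expr2 sqr_ge0.
have [[i j] /= xE] := mx_norm_neq0 x0.
rewrite [i]ord1 in xE; rewrite [`|x|]xE real_normK ?num_real//.
rewrite /dot (bigD1 j)//= -expr2 lerDl sumr_ge0// => k _.
by rewrite -expr2 sqr_ge0.
Qed.

Lemma norm_dot_le x y : `|dot x y| <= n%:R * (`|x| * `|y|).
Proof.
rewrite (le_trans (ler_norm_sum _ _ _))//.
rewrite mulr_natl -[X in _ *+ X]card_ord -sumr_const ler_sum// => i _.
by rewrite normrM ler_pM ?coord_le_norm.
Qed.

Lemma dot_le x y : dot x y <= n%:R * (`|x| * `|y|).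
Proof. exact: le_trans (ler_norm _) (norm_dot_le _ _). Qed.

Lemma enormE x : enorm x = Num.sqrt (dot x x).
Proof. by congr Num.sqrt; apply: eq_bigr => i _; rewrite expr2. Qed.

Lemma sqr_enorm x : enorm x ^+ 2 = dot x x.
Proof. by rewrite enormE sqr_sqrtr// (le_trans _ (norm_sqr_le_dot x))// sqr_ge0. Qed.

Lemma enorm_ge0 x : 0 <= enorm x.
Proof. exact: sqrtr_ge0. Qed.

Lemma norm_le_enorm x : `|x| <= enorm x.
Proof.
by rewrite -(@ler_pXn2r _ 2) ?nnegrE ?enorm_ge0// sqr_enorm norm_sqr_le_dot.
Qed.

(** The square of the left side is at most n |x|^2. The cruder constant [n.+1%:R] avoids a square
    root and stays positive for n = 0, so it can be divided by. *)
Lemma enorm_le_norm x : enorm x <= n.+1%:R * `|x|.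
Proof.
rewrite -(@ler_pXn2r _ 2) ?nnegrE ?enorm_ge0 ?mulr_ge0// sqr_enorm.
rewrite (le_trans (dot_le _ _))// exprMn -expr2 ler_wpM2r ?sqr_ge0//.
by rewrite -natrX ler_nat expnS expn1 (leq_trans (leqnSn n))// leq_pmulr.
Qed.

Lemma cvg_dot (T : Type) (F : set_system T) {FF : Filter F}
    (f g : T -> 'rV[R]_n) v w :
  f t @[t --> F] --> v -> g t @[t --> F] --> w ->
  dot (f t) (g t) @[t --> F] --> dot v w.
Proof.
move=> fv gw; apply: cvg_big => [|i _]; first exact: add_continuous.
have coordE := @coord_continuous R 1 n 0 i.
by apply: cvgM; [exact: (continuous_cvg _ (coordE v) fv)
                |exact: (continuous_cvg _ (coordE w) gw)].
Qed.

End EuclideanTheory.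

(** * Frechet subgradients as local affine minorants up to o(|y - x|) *)

Section FrechetSubdifferential.
Context {R : realType} {n : nat}.
Implicit Types (phi : 'rV[R]_n -> \bar R) (x y v w : 'rV[R]_n) (a e : R).

(** Clears the denominator while p may be infinite: for +oo both sides hold, for -oo both fail. *)
Lemma difference_quotient_ge (p : \bar R) (a d e r : R) : 0 < r ->
  ((- e)%:E <= (p - a%:E - d%:E) * (r^-1)%:E)%E =
  (a%:E + (d - e * r)%:E <= p)%E.
Proof.
move=> r0; case: p => [p| |] /=.
- by rewrite !lee_fin ler_pdivlMr// -lerN2 -[RHS]lerN2; apply/idP/idP; lra.
- by rewrite !addye// mulyr gtr0_sg ?invr_gt0// mul1e !leey.
- by rewrite !addNye mulNyr gtr0_sg ?invr_gt0// mul1e.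
Qed.

(** Equivalence of norms only rescales e, so the sup norm can replace the Euclidean one. The point y
    = x may be included, since the inequality is an equality there. *)
Lemma frechet_subdiffP phi x v :
  frechet_subdiff phi x v <->
  phi x \is a fin_num /\
  forall e, 0 < e -> \forall y \near x,
    (phi x + (dot v (y - x) - e * `|y - x|)%:E <= phi y)%E.
Proof.
split=> -[phix Hv]; split=> //.
  move=> e e0; have e'0 : 0 < e / n.+1%:R by rewrite divr_gt0.
  have : ((- (e / n.+1%:R))%:E < limf_einf (fun y =>
      (phi y - phi x - (dot v (y - x))%:E) * ((enorm (y - x))^-1)%:E) x^')%E.
    by rewrite (lt_le_trans _ Hv)// lte_fin oppr_lt0.
  rewrite limf_einfE => /ereal_sup_gt[_ [V Vx <-]] Ve; near=> y.
  have [->|yx] := eqVneq y x.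
    by rewrite subrr dot0r normr0 mulr0 subr0 adde0.
  have Vy : V y by move: yx; near: y; exact: Vx.
  have r0 : 0 < enorm (y - x).
    by rewrite (lt_le_trans _ (norm_le_enorm _))// normr_gt0 subr_eq0.
  have := le_trans (ltW Ve) (ereal_inf_lbound (imageP _ Vy)).
  move: phix => /fineK <-; rewrite difference_quotient_ge//.
  apply: le_trans; rewrite leeD2l// lee_fin lerD2l lerN2.
  by rewrite -mulrA ler_pM2l// ler_pdivrMl// enorm_le_norm.
apply/lee_addgt0Pr => e e0; rewrite limf_einfE -leeBlDr// sub0e.
apply: le_trans (ereal_sup_ubound (imageP _ (nbhs_dnbhs (Hv e e0)))).
apply/ereal_infP => _ [y /= Vy <-].
(* The neighbourhood given by [Hv] contains x itself, where the inverse of 0 is 0 and the quotient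
   takes the harmless value 0. *)
have [->|yx] := eqVneq y x.
  by rewrite subrr enormE dot0l sqrtr0 invr0 mule0 lee_fin oppr_le0 ltW.
have r0 : 0 < enorm (y - x).
  by rewrite (lt_le_trans _ (norm_le_enorm _))// normr_gt0 subr_eq0.
move: phix Vy => /fineK <-; rewrite difference_quotient_ge//; apply: le_trans.
by rewrite leeD2l// lee_fin lerD2l lerN2 ler_pM2l// norm_le_enorm.
Unshelve. all: by end_near. Qed.

End FrechetSubdifferential.

(** * Smooth perturbations, Fermat's rule, and indicator functions *)

Section FrechetCalculus.
Context {R : realType} {n : nat}.
Implicit Types (phi : 'rV[R]_n -> \bar R) (g : 'rV[R]_n -> R).
Implicit Types (x y v w : 'rV[R]_n) (C : set 'rV[R]_n) (a e : R).

(** A quadratic is o(|y - x|): the radius e / (|a| n + 1) suffices, the 1 keeping the denominator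
    positive. *)
Lemma near_dot_sqr_le x a e : 0 < e ->
  \forall y \near x, `|a * dot (y - x) (y - x)| <= e * `|y - x|.
Proof.
move=> e0; have K0 : 0 < `|a| * n%:R + 1 by rewrite ltr_wpDl ?mulr_ge0.
near=> y; have yx : `|y - x| < e / (`|a| * n%:R + 1).
  rewrite distrC; near: y; apply: (@cvgr_dist_lt _ _ _ _ _ id x) => //.
  by rewrite divr_gt0.
rewrite normrM (le_trans (ler_wpM2l _ (norm_dot_le _ _)))// !mulrA.
move: yx; rewrite ltr_pdivlMr// => /ltW yx; rewrite ler_wpM2r//.
by apply: le_trans yx; rewrite mulrC ler_wpM2l// lerDl.
Unshelve. all: by end_near. Qed.

Lemma frechet_subdiffD phi g x v w : frechet_subdiff phi x v ->
  (forall e, 0 < e -> \forall y \near x,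
     dot w (y - x) - e * `|y - x| <= g y - g x) ->
  frechet_subdiff (fun y => (g y)%:E + phi y)%E x (w + v).
Proof.
move=> /frechet_subdiffP[phix phiv] gw; apply/frechet_subdiffP.
split; first by rewrite fin_numD phix.
move=> e e0; have e20 : 0 < e / 2 by rewrite divr_gt0.
near=> y.
have h1 : (phi x + (dot v (y - x) - e / 2 * `|y - x|)%:E <= phi y)%E.
  by near: y; exact: phiv.
have h2 : dot w (y - x) - e / 2 * `|y - x| <= g y - g x.
  by near: y; exact: gw.
have h3 : ((g x + dot w (y - x) - e / 2 * `|y - x|)%:E <= (g y)%:E)%E.
  by rewrite lee_fin; move: h2; lra.
apply: le_trans (leeD h3 h1); move: phix => /fineK <-.
by rewrite -!EFinD lee_fin dotDl; lra.
Unshelve. all: by end_near. Qed.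

(** Fermat's rule: minimality bounds phi y - phi x below by g x - g y, so a first-order upper
    estimate of g is all that is required of it. *)
Lemma frechet_subdiff_localmin phi g x w : phi x \is a fin_num ->
  (\forall y \near x, ((g x)%:E + phi x <= (g y)%:E + phi y)%E) ->
  (forall e, 0 < e -> \forall y \near x,
     g y - g x <= dot w (y - x) + e * `|y - x|) ->
  frechet_subdiff phi x (- w).
Proof.
move=> phix minx gw; apply/frechet_subdiffP; split=> // e e0; near=> y.
have h1 : ((g x)%:E + phi x <= (g y)%:E + phi y)%E by near: y.
have h2 : g y - g x <= dot w (y - x) + e * `|y - x| by near: y; exact: gw.
rewrite -(@leeD2lE _ (g y)%:E)//; apply: le_trans h1; move: phix => /fineK <-.
by rewrite -!EFinD lee_fin dotNl; lra.
Unshelve. all: by end_near. Qed.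

(** The exact Taylor expansion at x, which identifies b + 2 d x as the gradient. *)
Lemma quad_expansion a (b : 'rV[R]_n) (d : R) x y :
  (a + dot b y + d * dot y y) - (a + dot b x + d * dot x x) =
  dot (b + (2 * d) *: x) (y - x) + d * dot (y - x) (y - x).
Proof. by rewrite !dotE (dotC y x); ring. Qed.

Lemma frechet_subdiff_quadD phi a (b : 'rV[R]_n) (d : R) x v :
  frechet_subdiff phi x v ->
  frechet_subdiff (fun y => (a + dot b y + d * dot y y)%:E + phi y)%E x
    (b + (2 * d) *: x + v).
Proof.
move=> phiv; apply: (frechet_subdiffD phiv) => e e0.
near=> y; rewrite quad_expansion lerD2l -lerN2 opprK (le_trans (ler_norm _))//.
by rewrite normrN; near: y; exact: near_dot_sqr_le.
Unshelve. all: by end_near. Qed.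

Lemma frechet_subdiff_quad_localmin phi a (b : 'rV[R]_n) (d : R) x :
  phi x \is a fin_num ->
  (\forall y \near x, ((a + dot b x + d * dot x x)%:E + phi x
                       <= (a + dot b y + d * dot y y)%:E + phi y)%E) ->
  frechet_subdiff phi x (- (b + (2 * d) *: x)).
Proof.
move=> phix minx; apply: (frechet_subdiff_localmin phix minx) => e e0.
near=> y; rewrite quad_expansion lerD2l (le_trans (ler_norm _))//.
by near: y; exact: near_dot_sqr_le.
Unshelve. all: by end_near. Qed.

Lemma chiT C x : C x -> chi C x = 0%E :> \bar R.
Proof. by rewrite /chi => Cx; rewrite mem_set. Qed.

Lemma chiF C x : ~ C x -> chi C x = +oo%E :> \bar R.
Proof. by rewrite /chi => Cx; rewrite memNset. Qed.

Lemma fin_num_addchi phi C x : (phi x + chi C x)%E \is a fin_num ->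
  [/\ phi x \is a fin_num, C x & (phi x + chi C x = phi x)%E].
Proof.
move=> fin; have := fin; rewrite fin_numD => /andP[phix].
have [Cx|/chiF->//] := pselect (C x).
by rewrite chiT// adde0.
Qed.

(** The values 0 and +oo of an indicator are unchanged by a positive factor, so Frechet normals form
    a cone; the tolerance e / a absorbs the scaling. *)
Lemma frechet_subdiff_chiZ C x v a : 0 < a ->
  frechet_subdiff (chi C) x v -> frechet_subdiff (chi C) x (a *: v).
Proof.
move=> a0 /frechet_subdiffP[Cx Hv]; apply/frechet_subdiffP; split=> // e e0.
have Cx' : chi C x = 0%E :> \bar R.
  by move: Cx; rewrite /chi; case: ifP.
have ea0 : 0 < e / a by rewrite divr_gt0.
near=> y; have : (chi C x + (dot v (y - x) - e / a * `|y - x|)%:E <= chi C y)%E.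
  by near: y; exact: Hv.
rewrite Cx' !add0e; have [Cy|/chiF->] := pselect (C y); last by rewrite !leey.
rewrite (chiT Cy) !lee_fin => h; rewrite dotZl.
have -> : a * dot v (y - x) - e * `|y - x| = a * (dot v (y - x) - e / a * `|y - x|).
  by field; rewrite gt_eqF.
by rewrite pmulr_rle0.
Unshelve. all: by end_near. Qed.

End FrechetCalculus.

(** * Lower semicontinuity and compactness *)

Section Compactness.
Context {R : realType} {T : topologicalType}.
Implicit Types (phi : T -> \bar R) (A : set T).

Lemma lower_semicontinuousD phi (g : T -> R) : lower_semicontinuous phi ->
  continuous g -> lower_semicontinuous (fun t => (g t)%:E + phi t)%E.
Proof.
move=> lphi cg t a agt.
(* The threshold a is split into b for phi and a - b for g, with slack on both sides; if phi t is
   +oo, any b above a - g t will do. *)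
have [b abg bphi] : exists2 b, a - b < g t & (b%:E < phi t)%E.
  move: agt; case: (phi t) => [r| |]//.
    rewrite -EFinD lte_fin => agr; exists (r - (g t + r - a) / 2); first lra.
    by rewrite lte_fin; lra.
  by exists (a - g t + 1); [lra|rewrite ltry].
have [V Vt Vphi] := lphi _ _ bphi.
exists (V `&` [set s | a - b < g s]).
  by apply: filterI => //; exact: (cvgr_gt _ (cg t)).
move=> s [/Vphi bs /= gs].
rewrite (lt_trans (_ : (a%:E < (g s)%:E + b%:E)%E))//.
  by rewrite -EFinD lte_fin; lra.
by rewrite lteD2lE.
Qed.

(** If the infimum m were not attained, the sublevel sets of A at levels above m would generate a
    proper filter. At a cluster point x one has m < phi x, and lower semicontinuity keeps a
    neighbourhood of x away from some of these sets. *)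
Lemma compact_lsc_min A phi : compact A -> A !=set0 ->
  lower_semicontinuous phi -> exists2 x, A x & forall y, A y -> (phi x <= phi y)%E.
Proof.
move=> cA [x0 Ax0] lphi; apply: contrapT => nomin.
pose m := ereal_inf (phi @` A).
have m_lt x : A x -> (m < phi x)%E.
  move=> Ax; rewrite ltNge; apply/negP => phixm; apply: nomin; exists x => // y Ay.
  by rewrite (le_trans phixm)//; apply: ereal_inf_lbound; exists y.
pose B (a : \bar R) := A `&` [set y | (phi y < a)%E].
have FF : ProperFilter (filter_from [set a | (m < a)%E] B).
  apply: filter_from_proper; first apply: filter_from_filter.
  - by exists (phi x0); exact: m_lt.
  - move=> a b /= ma mb; exists (Order.min a b); first by rewrite /= lt_min ma mb.
    by move=> y [Ay]; rewrite /= lt_min => /andP[].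
  - move=> a /= /ereal_inf_lt[_ [y Ay <-] ya]; by exists y.
have [|x [Ax xF]] := cA _ FF.
  by exists (phi x0); [exact: m_lt|move=> y []].
(* Lower semicontinuity takes real thresholds, whereas m may be -oo and phi x may be +oo. *)
have [a ma aphi] : exists2 a : R, (m < a%:E)%E & (a%:E < phi x)%E.
  have := m_lt _ Ax; case: (m) (phi x) => [r| |] [s| |]//.
  - by rewrite lte_fin => rs; exists ((r + s) / 2); rewrite lte_fin; lra.
  - by move=> _; exists (r + 1); rewrite ?ltry// lte_fin; lra.
  - by move=> _; exists (s - 1); rewrite ?ltNyr// lte_fin; lra.
  - by move=> _; exists 0; rewrite ?ltry ?ltNyr.
have [V Vx aV] := lphi _ _ aphi.
have [y [[_ /= ya] /aV]] : B a%:E `&` V !=set0.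
  by apply: xF => //; exists a%:E.
by rewrite ltNge (ltW ya).
Qed.

(** Visits to every neighbourhood at arbitrarily late indices serve in place of a convergent
    subsequence. *)
Lemma compact_seq_cluster A (u : nat -> T) : compact A -> (forall k, A (u k)) ->
  exists2 p, A p & forall K V, nbhs p V -> exists2 k, (K <= k)%N & V (u k).
Proof.
move=> cA Au; have [|p [Ap up]] := cA (u @ \oo) _.
  by exists 0%N => // k _; exact: Au.
exists p => // K V pV.
have [_ [[k Kk <-] Vk]] : [set u k | k in [set k | (K <= k)%N]] `&` V !=set0.
  by apply: up => //; exists K => // k Kk; exists k.
by exists k.
Qed.

End Compactness.

(** * The fuzzy sum rule for a function plus an indicator *)

Section FuzzySumRule.
Context {R : realType} {n : nat}.
Implicit Types (phi : 'rV[R]_n -> \bar R) (x y z v w : 'rV[R]_n).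
Implicit Types (C : set 'rV[R]_n) (e r : R).

Lemma compact_norm_ball x r : compact [set y | `|y - x| <= r].
Proof.
apply: bounded_closed_compact.
  exists (r + `|x|); split; first exact: num_real.
  move=> M /ltW rM y /= yr; rewrite (le_trans _ rM)//.
  by rewrite -[y in leLHS](subrK x) (le_trans (ler_normD _ _))// lerD2r.
rewrite -[X in closed X]/((fun y => `|y - x|) @^-1` [set t | t <= r]).
apply: preimage_closed; last exact: closed_le.
by move=> y _; exact: (cvg_norm (cvgB cvg_id (cvg_cst x))).
Qed.

Lemma near_norm_ball x r : 0 < r -> \forall y \near x, `|y - x| < r.
Proof.
move=> r0; near=> y; rewrite distrC; near: y.
exact: (@cvgr_dist_lt _ _ _ _ _ id x).
Unshelve. all: by end_near. Qed.

Lemma near_norm_ballP x (P : set 'rV[R]_n) : (\forall y \near x, P y) ->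
  exists2 r, 0 < r & forall y, `|y - x| < r -> P y.
Proof.
move=> /nbhs_normP[r /= r0 rP]; exists r => // y yr; apply: rP.
by rewrite /ball_/= distrC.
Qed.

Lemma dot_sub_expansion x y z :
  dot (y - x) (y - x) =
  dot (z - x) (z - x) + 2 * dot (z - x) (y - z) + dot (y - z) (y - z).
Proof. by rewrite !dotE (dotC y x) (dotC z x) (dotC y z); ring. Qed.

Lemma pair_dot_cvg (q : 'rV[R]_n * 'rV[R]_n) :
  dot (p.1 - p.2) (p.1 - p.2) @[p --> q] --> dot (q.1 - q.2) (q.1 - q.2).
Proof.
have q12 : p.1 - p.2 @[p --> q] --> q.1 - q.2 by exact: (cvgB cvg_fst cvg_snd).
exact: cvg_dot.
Qed.

(* The gap [y - z] between the two copies of the variable is penalised with a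
   weight k that tends to infinity; the term in [c] keeps the minimisers inside
   the ball without destroying smoothness. *)
Lemma fuzzy_sum_rule phi C x v e : lower_semicontinuous phi ->
  (forall y, phi y != -oo%E) -> closed C -> 0 < e ->
  frechet_subdiff (fun y => phi y + chi C y)%E x v ->
  exists y z v1 w,
    [/\ `|y - x| <= e /\ `|z - x| <= e,
        C z /\ (phi x - e%:E <= phi y <= phi x + e%:E)%E,
        frechet_subdiff phi y v1,
        frechet_subdiff (chi C) z w &
        `|v - v1 - w| <= e].
Proof.
move=> lphi phiNy clC e0 /frechet_subdiffP[/fin_num_addchi[phix Cx phixC] phiv].
set fx := fine (phi x); have fxE : phi x = fx%:E by rewrite fineK.
have e40 : 0 < e / 4 by rewrite divr_gt0.
have [r1 r10 phiv'] := near_norm_ballP (phiv _ e40).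
have [V /near_norm_ballP[r2 r20 r2V] Vphi] : exists2 V : set 'rV[R]_n,
    nbhs x V & forall y, V y -> ((fx - e)%:E < phi y)%E.
  by apply: lphi; rewrite fxE lte_fin gtrBl.
pose K := n%:R * `|v|; have K0 : 0 <= K by rewrite mulr_ge0.
(* The halves of r1 and r2 make both local estimates available on the closed ball of radius r, e / 2
   controls the distance to x, and e / (K + 1) yields v.(y - x) <= e there. *)
pose r := Num.min (Num.min (r1 / 2) (r2 / 2)) (Num.min (e / 2) (e / (K + 1))).
have r0 : 0 < r by rewrite !lt_min !divr_gt0// ltr_wpDl.
have /andP[/andP[rr1 rr2] /andP[re rK]] :
    (r <= r1 / 2) && (r <= r2 / 2) && ((r <= e / 2) && (r <= e / (K + 1))).
  by rewrite -!le_min.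
have {rK}rK : K * r <= e.
  by move: rK; rewrite ler_pdivlMr ?ltr_wpDl//; lra.
(* With c r = e, the quadratic term dominates (e / 4) |y - x| as soon as |y - x| >= r / 2, yet its
   gradient 2 c (y - x) has norm at most e inside the ball of radius r / 2. *)
pose c := e / r; have c0 : 0 < c by rewrite divr_gt0.
have cr : c * r = e by rewrite /c mulfVK ?gt_eqF.
have dotv y : `|y - x| <= r -> dot v (y - x) <= e.
  move=> yr; rewrite (le_trans (dot_le _ _))// mulrA (le_trans _ rK)//.
  by rewrite ler_wpM2l.
pose th y := (- dot v (y - x) + c * dot (y - x) (y - x))%R.
have thx : th x = 0 by rewrite /th subrr !dot0r; lra.
pose B := [set y | `|y - x| <= r].
pose G (k : nat) (q : 'rV[R]_n * 'rV[R]_n) : \bar R :=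
  ((th q.1 + k%:R * dot (q.1 - q.2) (q.1 - q.2))%:E + phi q.1)%E.
have cB : compact (B `*` (C `&` B)).
  apply: compact_setX; first exact: compact_norm_ball.
  by rewrite setIC; apply: compact_closedI => //; exact: compact_norm_ball.
have Bx : B x by rewrite /B/= subrr normr0 ltW.
have thcts : continuous th.
  move=> y; have yxcvg : z - x @[z --> y] --> y - x.
    exact: (cvgB cvg_id (cvg_cst x)).
  rewrite /th.
  exact: (cvgD (cvgN (cvg_dot (cvg_cst v) yxcvg))
               (cvgM (cvg_cst c) (cvg_dot yxcvg yxcvg))).
have lG k : lower_semicontinuous (G k).
  apply: (@lower_semicontinuousD _ _ (fun q => phi q.1)).
    move=> q a /lphi[U Uq Ua]; exists (fst @^-1` U); first exact: cvg_fst.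
    by move=> q' /Ua.
  move=> q; have th1 : th t.1 @[t --> q] --> th q.1.
    have q1 : t.1 @[t --> q] --> q.1 by exact: cvg_fst.
    exact: (cvg_comp _ _ q1 (thcts q.1)).
  exact: (cvgD th1 (cvgM (cvg_cst (k%:R : R)) (@pair_dot_cvg q))).
have /choice[q qmin] k : exists q, (B `*` (C `&` B)) q /\
    forall q', (B `*` (C `&` B)) q' -> (G k q <= G k q')%E.
  by have [|q Bq qm] := compact_lsc_min cB _ (lG k); [exists (x, x)|exists q].
(* The competitor is (x, x), where both [th] and the penalty vanish. *)
have Gqx k : (G k (q k) <= phi x)%E.
  have /(_ (x, x)) := (qmin k).2; rewrite {2}/G/= subrr dot0r mulr0 addr0 thx.
  by rewrite add0e; apply.
have phigt y : `|y - x| <= r -> ((fx - e)%:E < phi y)%E.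
  by move=> yr; apply/Vphi/r2V; lra.
have thge y : `|y - x| <= r -> - e <= th y.
  move=> yr; have := dotv _ yr; have := norm_sqr_le_dot (y - x).
  have := sqr_ge0 `|y - x|; rewrite /th; nra.
(* On the ball phi exceeds phi x - e and [th] is at least -e, which leaves at most 2 e for the
   penalty. *)
have gap k : k%:R * dot ((q k).1 - (q k).2) ((q k).1 - (q k).2) <= 2 * e.
  have [[q1B _] _] := qmin k; have := phigt _ q1B; have := thge _ q1B.
  have := Gqx k; rewrite fxE /G; case: (phi (q k).1) => [t| |]//.
  by rewrite -EFinD !lee_fin !lte_fin; lra.
have [p [p1B [p2C p2B]] pq] := compact_seq_cluster cB (fun k => (qmin k).1).
have p12 : p.1 = p.2.
  apply/eqP; rewrite -subr_eq0 -normr_eq0; apply: contrapT => /negP pn0.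
  have d0 : 0 < `|p.1 - p.2| ^+ 2 by rewrite exprn_gt0// lt_neqAle eq_sym pn0/=.
  have dd0 : 0 < dot (p.1 - p.2) (p.1 - p.2).
    by rewrite (lt_le_trans d0)// norm_sqr_le_dot.
  set d := dot _ _ in dd0.
  have pV : nbhs p [set q | d / 2 < dot (q.1 - q.2) (q.1 - q.2)].
    have : d / 2 < d by lra.
    exact: (cvgr_gt _ (@pair_dot_cvg p)).
  (* From index N on, k d / 2 > 2 e, whereas [pq] supplies such a k with squared gap above d / 2;
     this contradicts [gap]. *)
  pose N := (Num.truncn (4 * e / d)).+1.
  have [k Nk /= dk] := pq N _ pV.
  have := gap k; have : 4 * e / d < k%:R.
    apply: lt_le_trans (truncnS_gt _) _; by rewrite ler_nat.
  rewrite ltr_pdivrMr//; set D := dot _ _ in dk *; nra.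
(* The nonnegative penalty is dropped and lower semicontinuity passes the bound [Gqx] to the cluster
   point. *)
have thp : ((th p.1)%:E + phi p.1 <= phi x)%E.
  rewrite leNgt; apply/negP; rewrite {1}fxE.
  have lth := lower_semicontinuousD lphi thcts.
  move=> /lth[U Up Ugt].
  have pU : nbhs p (fst @^-1` U) by exact: cvg_fst.
  have [k _ /Ugt] := pq 0%N _ pU; rewrite -fxE ltNge => /negP; apply.
  apply: le_trans (Gqx k); rewrite /G leeD2r// lee_fin lerDl mulr_ge0//.
  by rewrite (le_trans _ (norm_sqr_le_dot _))// sqr_ge0.
(* As p.1 is in C, the subgradient inequality at x applies to it; together with [thp] it gives c t^2
   <= (e / 4) t for t = |p.1 - x|, which excludes t >= r / 2. *)
have p1x : `|p.1 - x| < r / 2.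
  have Cp : C p.1 by rewrite p12.
  have /phiv' : `|p.1 - x| < r1 by move: p1B; rewrite /B/=; lra.
  rewrite phixC chiT// adde0; move: thp; rewrite fxE.
  case: (phi p.1) => [t| |]//; rewrite -!EFinD !lee_fin /th.
  have := norm_sqr_le_dot (p.1 - x); have := normr_ge0 (p.1 - x).
  set t' := `|_| => t'0 dott' h1 h2; rewrite ltNge; apply/negP => t'r.
  have : c * t' ^+ 2 <= e / 4 * t' by nra.
  rewrite expr2 mulrA ler_pM2r; last by lra.
  have : e / 2 <= c * t' by rewrite -cr -mulrA ler_pM2l.
  by move: e0; lra.
have pV : nbhs p [set q | `|q.1 - x| < r / 2 /\ `|q.2 - x| < r / 2].
  move: (p1x) (p1x); rewrite {2}p12 => ltp1 ltp2.
  have p1cvg : q.1 - x @[q --> p] --> p.1 - x.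
    exact: (cvgB cvg_fst (cvg_cst x)).
  have p2cvg : q.2 - x @[q --> p] --> p.2 - x.
    exact: (cvgB cvg_snd (cvg_cst x)).
  by apply: filterI; [exact: (cvgr_lt _ (cvg_norm p1cvg) _ ltp1)
                     |exact: (cvgr_lt _ (cvg_norm p2cvg) _ ltp2)].
have [k _ /= [yr zr]] := pq 0%N _ pV.
move: (qmin k) (Gqx k) yr zr; case: (q k) => y z /= -[[yB [zC zB]] qm] Gx yr zr.
have phiy : phi y \is a fin_num.
  by move: Gx; rewrite /G fxE; have := phiNy y; case: (phi y).
(* The witnesses are minus the partial gradients at (y, z) of the smooth part of [G k]: Fermat's
   rule in y with z fixed, then in z with y fixed. Both points are within r / 2 of x, so [B] is
   inactive. The penalty cancels in the sum of the witnesses, leaving v - 2 c (y - x). *)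
exists y, z, (v - (2 * c) *: (y - x) - (2 * k%:R) *: (y - z)), ((2 * k%:R) *: (y - z)).
split.
- by split; lra.
- split=> //; apply/andP; split; first by rewrite fxE -EFinB ltW// phigt.
  move: Gx; rewrite /G/= -(fineK phiy) fxE -!EFinD !lee_fin /th.
  have := dotv _ yB; have := norm_sqr_le_dot (y - x); have := sqr_ge0 `|y - x|.
  have := norm_sqr_le_dot (y - z); have := sqr_ge0 `|y - z|.
  have : 0 <= k%:R :> R by [].
  move: k%:R => k' ? ? ? ? ? ? ?; nra.
- rewrite (_ : v - _ - _ = - (- v + (2 * c) *: (y - x) + (2 * k%:R) *: (y - z))).
    apply: (@frechet_subdiff_localmin _ _ _
      (fun y => th y + k%:R * dot (y - z) (y - z))%R) => //.
      near=> y'; have := qm (y', z); apply; split=> //; rewrite /B/=.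
      rewrite -[y' - x](subrKA y) (le_trans (ler_normD _ _))//.
      have : `|y' - y| < r / 2 by near: y'; apply: near_norm_ball; rewrite divr_gt0.
      lra.
    move=> e' e'0; near=> y'.
    have : `|(c + k%:R) * dot (y' - y) (y' - y)| <= e' * `|y' - y|.
      by near: y'; exact: near_dot_sqr_le.
    move=> /(le_trans (ler_norm _)).
    rewrite /th (dot_sub_expansion x y' y) (dot_sub_expansion z y' y).
    have -> : dot v (y' - x) = dot v (y' - y) + dot v (y - x).
      by rewrite -dotDr subrKA.
    rewrite !(dotDl (- v + _)) (dotDl (- v)) (dotNl v) !dotZl.
    clear; lra.
  by rewrite !opprD !opprK.
- rewrite -[_ *: _]opprK -scalerN opprB.
  apply: (@frechet_subdiff_localmin _ _ _
    (fun z' => k%:R * dot (z' - y) (z' - y))%R); first by rewrite chiT.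
    near=> z'; rewrite (chiT zC) adde0.
    have [Cz'|/chiF->] := pselect (C z'); last by rewrite addey// leey.
    rewrite (chiT Cz') adde0 lee_fin.
    have : (G k (y, z) <= G k (y, z'))%E.
      apply: qm; split=> //; split=> //; rewrite /B/=.
      rewrite -[z' - x](subrKA z) (le_trans (ler_normD _ _))//.
      have : `|z' - z| < r / 2.
        by near: z'; apply: near_norm_ball; rewrite divr_gt0.
      lra.
    rewrite /G/= -(fineK phiy) -!EFinD lee_fin lerD2r lerD2l.
    by rewrite -(opprB z) -(opprB z' y) !dotNl !dotNr !opprK.
  move=> e' e'0; near=> z'.
  have : `|k%:R * dot (z' - z) (z' - z)| <= e' * `|z' - z|.
    by near: z'; exact: near_dot_sqr_le.
  move=> /(le_trans (ler_norm _)); rewrite (dot_sub_expansion y z' z) dotZl.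
  clear; lra.
- rewrite (_ : v - _ - _ = (2 * c) *: (y - x)).
    rewrite normrZ gtr0_norm; last exact: mulr_gt0.
    rewrite -cr.
    rewrite [2 * c]mulrC -mulrA ler_pM2l//.
    by move: yr; clear; lra.
  rewrite !opprD !opprK !addrA subrr add0r.
  by rewrite addrK.
Unshelve. all: by end_near. Qed.

End FuzzySumRule.

(** * Limiting subgradients and the exact sum rule *)

Section LimitingSubdifferentials.
Context {R : realType} {n : nat}.
Implicit Types (phi : 'rV[R]_n -> \bar R) (x y z v w : 'rV[R]_n).
Implicit Types (C : set 'rV[R]_n) (e a : R).

Lemma harmonic_small e : 0 < e ->
  exists K, forall k, (K <= k)%N -> harmonic k <= e :> R.
Proof.
move=> e0; have [K _ KP] := cvgr_le _ (@cvg_harmonic R) _ e0.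
by exists K => k /KP.
Qed.

Lemma cvg_le_harmonic (u : nat -> 'rV[R]_n) x :
  (forall k, `|u k - x| <= harmonic k) -> u k @[k --> \oo] --> x.
Proof.
move=> ux; apply/cvgrPdist_le => e e0; have [K KP] := harmonic_small e0.
by exists K => // k /KP; apply: le_trans; rewrite distrC.
Qed.

Lemma cvge_le_harmonic (u : nat -> \bar R) (l : \bar R) : l \is a fin_num ->
  (forall k, (l - (harmonic k)%:E <= u k <= l + (harmonic k)%:E)%E) ->
  u k @[k --> \oo] --> l.
Proof.
move=> /fineK <-; set r := fine l => ul.
have ufin k : u k \is a fin_num.
  by have := ul k; case: (u k) => [t| |]//; rewrite -EFinD ?leye_eq ?andbF.
apply/fine_cvgP; split; first exact: nearW.
apply/cvgrPdist_le => e e0; have [K KP] := harmonic_small e0.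
exists K => // k /KP; apply: le_trans.
have : `|r - fine (u k)| <= harmonic k; last by [].
have := ul k; rewrite -(fineK (ufin k)) -EFinB -EFinD !lee_fin => /andP[? ?].
by rewrite ler_distl; apply/andP; split; lra.
Qed.

(** Trades sequences for one approximate subgradient per tolerance; conversely, choosing one at each
    tolerance [harmonic k] rebuilds the sequences. *)
Lemma subdiff_approxP phi x v :
  subdiff phi x v <->
  phi x \is a fin_num /\
  forall e, 0 < e -> exists y w,
    [/\ `|y - x| <= e, `|w - v| <= e,
        (phi x - e%:E <= phi y <= phi x + e%:E)%E & frechet_subdiff phi y w].
Proof.
split=> -[phix].
  move=> [xs [vs [xs_x vs_v phixs fr]]]; split=> // e e0.
  have near_e : \forall k \near \oo,
      [/\ `|x - xs k| <= e, `|v - vs k| <= e &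
          (phi x - e%:E <= phi (xs k) <= phi x + e%:E)%E].
    move: phixs; rewrite -(fineK phix) => /fine_cvgP[phifin phixs].
    near=> k; split.
    - by near: k; apply: cvgr_dist_le.
    - by near: k; apply: cvgr_dist_le.
    - have -> : phi (xs k) = (fine (phi (xs k)))%:E.
        by rewrite fineK//; near: k.
      have : `|fine (phi x) - fine (phi (xs k))| <= e.
        by near: k; exact: (cvgr_dist_le _ _ phixs _ e0).
      rewrite ler_distl => /andP[? ?]; rewrite -EFinB -EFinD !lee_fin.
      by apply/andP; split; lra.
  have [k [xk vk phik]] := filter_ex near_e.
  by exists (xs k), (vs k); rewrite -(distrC x) -(distrC v).
move=> H; split=> //.
have /choice[t tP] k := H (harmonic k) (harmonic_gt0 k).
have /choice[s sP] := tP.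
exists t, s; split=> [| | |k]; last by case: (sP k).
- by apply: cvg_le_harmonic => k; case: (sP k).
- by apply: cvg_le_harmonic => k; case: (sP k).
- by apply: cvge_le_harmonic => // k; case: (sP k).
Unshelve. all: by end_near. Qed.

Lemma horizon_subdiff_approx phi x v : phi x \is a fin_num ->
  (forall e, 0 < e -> exists y w a,
    [/\ 0 < a <= e, `|y - x| <= e, `|a *: w - v| <= e,
        (phi x - e%:E <= phi y <= phi x + e%:E)%E & frechet_subdiff phi y w]) ->
  horizon_subdiff phi x v.
Proof.
move=> phix H; split=> //.
have /choice[t tP] k := H (harmonic k) (harmonic_gt0 k).
have /choice[s sP] := tP; have /choice[a aP] := sP.
exists t, s, a; split=> [|||  |].
- by apply: cvg_le_harmonic => k; case: (aP k).
- split=> [k|]; first by case: (aP k) => /andP[].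
  apply/cvgrPdist_le => e e0; have [K KP] := harmonic_small e0.
  exists K => // k /KP; apply: le_trans; case: (aP k) => /andP[a0 ak] _ _ _ _.
  by rewrite sub0r normrN gtr0_norm.
- by move=> k; case: (aP k).
- by apply: cvge_le_harmonic => // k; case: (aP k).
- by apply: cvg_le_harmonic => k; case: (aP k).
Qed.

(** Convergence of function values is automatic here, because the indicator is 0 at x and at each
    z. *)
Lemma normal_cone_approx C x v : C x ->
  (forall e, 0 < e -> exists z w,
    [/\ C z, `|z - x| <= e, `|w - v| <= e & frechet_subdiff (chi C) z w]) ->
  normal_cone C x v.
Proof.
move=> Cx H; apply/subdiff_approxP; rewrite chiT//; split=> // e e0.
have [z [w [Cz zx wv fr]]] := H e e0; exists z, w; split=> //.
by rewrite chiT// sub0e add0e -EFinN !lee_fin oppr_le0 ltW.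
Qed.

(** Half of e goes into replacing v by a Frechet subgradient at a nearby point, half into the fuzzy
    rule there. Packing points in t.1 and subgradients in t.2 lets a single choice produce the whole
    sequence. *)
Lemma subdiff_approx_sum phi C x v e : lower_semicontinuous phi ->
  (forall y, phi y != -oo%E) -> closed C ->
  subdiff (fun y => phi y + chi C y)%E x v -> 0 < e ->
  exists (t : ('rV[R]_n * 'rV[R]_n) * ('rV[R]_n * 'rV[R]_n)),
    [/\ `|t.1.1 - x| <= e /\ `|t.1.2 - x| <= e,
        C t.1.2 /\ (phi x - e%:E <= phi t.1.1 <= phi x + e%:E)%E,
        frechet_subdiff phi t.1.1 t.2.1,
        frechet_subdiff (chi C) t.1.2 t.2.2 &
        `|v - t.2.1 - t.2.2| <= e].
Proof.
move=> lphi phiNy clC /subdiff_approxP[/fin_num_addchi[phix Cx phixC] vP] e0.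
have e20 : 0 < e / 2 by rewrite divr_gt0.
have [x' [v' [x'x v'v phix' fr]]] := vP _ e20.
have /frechet_subdiffP[/fin_num_addchi[phix'fin Cx' phix'C] _] := fr.
have [y [z [v1 [w [[yx zx] [Cz phiy] fr1 fr2 vw]]]]] :=
  fuzzy_sum_rule lphi phiNy clC e20 fr.
have near2 (p q : 'rV[R]_n) : `|p - q| <= e / 2 -> `|q - x| <= e / 2 -> `|p - x| <= e.
  by move=> pq qx; rewrite -(subrKA q) (le_trans (ler_normD _ _))//; lra.
exists ((y, z), (v1, w)); split=> //=.
- by split; apply: near2 x'x.
- split=> //; move: phiy phix'; rewrite phixC phix'C.
  rewrite -(fineK phix) -(fineK phix'fin).
  case: (phi y) => [s| |]; rewrite -?EFinB -?EFinD ?leye_eq ?andbF//.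
  by rewrite !lee_fin; lra.
- rewrite (_ : v - v1 - w = (v' - v1 - w) + (v - v')).
    by rewrite (le_trans (ler_normD _ _))// (distrC v); lra.
  by apply/rowP => i; rewrite !mxE; ring.
Qed.

Lemma subdiff_sum_rule phi C x v : lower_semicontinuous phi ->
  (forall y, phi y != -oo%E) -> closed C ->
  (forall w, horizon_subdiff phi x w -> normal_cone C x (- w) -> w = 0) ->
  subdiff (fun y => phi y + chi C y)%E x v ->
  exists v1 w, [/\ subdiff phi x v1, normal_cone C x w & v = v1 + w].
Proof.
move=> lphi phiNy clC cq phiv.
have [/fin_num_addchi[phix Cx _] _] := phiv.
have /choice[t tP] k := subdiff_approx_sum lphi phiNy clC phiv
  (harmonic_gt0 k).
have near_phi e k : harmonic k <= e ->
    (phi x - e%:E <= phi (t k).1.1 <= phi x + e%:E)%E.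
  move=> ke; have [_ [_ /andP[h1 h2]] _ _ _] := tP k; apply/andP; split.
    by apply: le_trans h1; rewrite leeB// lee_fin.
  by apply: le_trans h2 _; rewrite leeD2l// lee_fin.
(* Boundedness is asked only at arbitrarily late indices, which is enough for a cluster point; its
   failure means that the norms tend to infinity. *)
have [[M bounded]|unbounded] :=
    pselect (exists M, forall K, exists2 k, (K <= k)%N & `|(t k).2.1| <= M).
  have /choice[j jP] K : exists k, (K <= k)%N /\ `|(t k).2.1 - 0| <= M.
    by have [k Kk kM] := bounded K; exists k; rewrite subr0.
  have [v1 _ v1P] := compact_seq_cluster (@compact_norm_ball _ _ 0 M)
                                         (fun K => (jP K).2).
  have v1_near e : 0 < e ->
      exists2 k, harmonic k <= e :> R & `|(t k).2.1 - v1| <= e.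
    move=> e0; have [K KP] := harmonic_small e0.
    have [m Km jm] := v1P K _ (near_norm_ball v1 e0); exists (j m); last exact: ltW.
    by apply/KP/(leq_trans Km); case: (jP m).
  (* The normal part is defined as the remainder v - v1; since the residuals tend to 0, the normals
     t.2.2 approximate it. *)
  exists v1, (v - v1); split; last by rewrite addrC subrK.
    apply/subdiff_approxP; split=> // e /v1_near[k ke kv1].
    have [[yx _] _ fr _ _] := tP k.
    exists (t k).1.1, (t k).2.1; split=> //; first exact: le_trans ke.
    exact: near_phi.
  apply: normal_cone_approx => // e e0.
  have e20 : 0 < e / 2 by rewrite divr_gt0.
  have [k ke kv1] := v1_near _ e20.
  have [[_ zx] [Cz _] _ fr vw] := tP k.
  exists (t k).1.2, (t k).2.2; split=> //.
    by rewrite (le_trans zx)// (le_trans ke)//; lra.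
  rewrite distrC (_ : v - v1 - _ = (v - (t k).2.1 - (t k).2.2) + ((t k).2.1 - v1)).
    by rewrite (le_trans (ler_normD _ _))//; lra.
  by apply/rowP => i; rewrite !mxE; ring.
have /choice[j jP] m : exists k, (m <= k)%N /\ m.+1%:R < `|(t k).2.1|.
  apply: contrapT => none; apply: unbounded; exists m.+1%:R => K.
  exists (maxn K m); first exact: leq_maxl.
  rewrite leNgt; apply/negP => big; apply: none; exists (maxn K m).
  by rewrite leq_maxr.
(* As the norm exceeds m + 1, this multiplier is at most [harmonic m] and so tends to 0, as the
   horizon subdifferential requires. *)
pose a m := `|(t (j m)).2.1|^-1.
have v1pos m : 0 < `|(t (j m)).2.1| by rewrite (lt_trans _ (jP m).2).
have a0 m : 0 < a m by rewrite invr_gt0.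
have am m : a m <= harmonic m.
  by rewrite /a/harmonic lef_pV2 ?posrE// ltW// (jP m).2.
pose u m := a m *: (t (j m)).2.1.
have u1 m : `|u m| = 1.
  by rewrite normrZ gtr0_norm// mulVf// gt_eqF.
have uball m : `|u m - 0| <= 1 by rewrite subr0 u1.
have [p _ pP] := compact_seq_cluster (@compact_norm_ball _ _ 0 1) uball.
(* The normalised subgradients have norm 1, so they cannot cluster at 0. *)
suff p0 : p = 0.
  have [m _] := pP 0%N _ (near_norm_ball p ltr01).
  by rewrite p0 subr0 u1 ltxx.
have p_near e : 0 < e -> exists m, [/\ harmonic (j m) <= e :> R,
    a m <= e & `|u m - p| <= e].
  move=> e0; have [K KP] := harmonic_small e0.
  have [m Km jm] := pP K _ (near_norm_ball p e0); exists m; split.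
  - by apply/KP/(leq_trans Km); case: (jP m).
  - by rewrite (le_trans (am m))// KP.
  - exact: ltW.
apply: cq.
  apply: horizon_subdiff_approx => // e /p_near[m [je ae pe]].
  have [[yx _] _ fr _ _] := tP (j m).
  exists (t (j m)).1.1, (t (j m)).2.1, (a m); split=> //.
  - by rewrite a0.
  - exact: le_trans je.
  - exact: near_phi.
apply: normal_cone_approx => // e e0.
(* The scaled normal differs from - p by a (v - residual) minus (u - p). Since d <= 1 bounds the
   residual by 1, the error is at most d (|v| + 1) + d, which is at most e. *)
pose d := Num.min 1 (e / (`|v| + 2)).
have v20 : 0 < `|v| + 2 by rewrite ltr_wpDl.
have d0 : 0 < d by rewrite lt_min ltr01 divr_gt0.
have [d1 de] : d <= 1 /\ d * (`|v| + 2) <= e.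
  by rewrite -ler_pdivlMr//; apply/andP; rewrite -le_min.
have [m [jd ad pd]] := p_near d d0.
have [[_ zx] [Cz _] _ fr vw] := tP (j m).
exists (t (j m)).1.2, (a m *: (t (j m)).2.2); split=> //.
- rewrite (le_trans zx)// (le_trans jd)// (le_trans _ de)//.
  rewrite ler_peMr ?(ltW d0)//; have := normr_ge0 v; lra.
- rewrite opprK (_ : _ + p =
    (a m *: v - a m *: (v - (t (j m)).2.1 - (t (j m)).2.2)) - (u m - p)).
    rewrite (le_trans (ler_normB _ _))// -scalerBr normrZ (gtr0_norm (a0 m)).
    have h1 : `|v - (v - (t (j m)).2.1 - (t (j m)).2.2)| <= `|v| + 1.
      by rewrite (le_trans (ler_normB _ _))// lerD2l (le_trans vw)// (le_trans jd).
    have := ler_pM (ltW (a0 m)) (normr_ge0 _) ad h1; lra.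
  by apply/rowP => i; rewrite !mxE; ring.
- exact: frechet_subdiff_chiZ.
Qed.

End LimitingSubdifferentials.

(** * Quadratic perturbations, translations, and the box *)

Section ModelSubdifferentials.
Context {R : realType} {n : nat}.
Implicit Types (phi : 'rV[R]_n -> \bar R) (x y s v w b : 'rV[R]_n).
Implicit Types (C : set 'rV[R]_n) (a d : R) (l u : 'rV[\bar R]_n).

Lemma frechet_subdiff_subset phi x : frechet_subdiff phi x `<=` subdiff phi x.
Proof.
move=> v fr; have [phix _] := fr; split=> //.
by exists (fun=> x), (fun=> v); split=> //; exact: cvg_cst.
Qed.

Lemma quad_continuous a b d :
  continuous (fun y : 'rV[R]_n => a + dot b y + d * dot y y)%R.
Proof.
move=> y; have yy : t @[t --> y] --> y by exact: cvg_id.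
exact: (cvgD (cvgD (cvg_cst a) (cvg_dot (cvg_cst b) yy))
             (cvgM (cvg_cst d) (cvg_dot yy yy))).
Qed.

(** The Frechet rule is applied along the same sequences. Taken with opposite coefficients, it also
    removes a quadratic. *)
Lemma subdiff_quadD phi a b d x v : subdiff phi x v ->
  subdiff (fun y => (a + dot b y + d * dot y y)%:E + phi y)%E x
    (b + (2 * d) *: x + v).
Proof.
move=> [phix [xs [vs [xs_x vs_v phixs fr]]]].
split; first by rewrite fin_numD phix.
exists xs, (fun k => b + (2 * d) *: xs k + vs k); split=> //.
- by apply: cvgD => //; apply: cvgD; [exact: cvg_cst|exact: cvgZr].
- have qs : (a + dot b (xs k) + d * dot (xs k) (xs k))%:E @[k --> \oo] -->
      (a + dot b x + d * dot x x)%:E.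
    apply: cvg_EFin; first exact: nearW.
    exact: (cvg_comp _ _ xs_x (@quad_continuous a b d x)).
  exact: (cvgeD (fin_num_adde_defl _ phix) qs phixs).
- by move=> k; exact: frechet_subdiff_quadD.
Qed.

Lemma frechet_subdiff_translate phi x s v :
  frechet_subdiff (fun t => phi (x + t)) s v -> frechet_subdiff phi (x + s) v.
Proof.
move=> /frechet_subdiffP[phix Hv]; apply/frechet_subdiffP; split=> // e e0.
have ycvg : y - x @[y --> x + s] --> s.
  have : y - x @[y --> x + s] --> x + s - x by exact: (cvgB cvg_id (cvg_cst x)).
  by rewrite [x + s - x]addrAC subrr add0r.
near=> y.
have : (phi (x + s)%R + (dot v (y - x - s) - e * `|y - x - s|)%:E
        <= phi (x + (y - x))%R)%E by near: y; exact: (ycvg _ (Hv e e0)).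
by rewrite subrKC opprD addrA.
Unshelve. all: by end_near. Qed.

Lemma subdiff_translate phi x s v :
  subdiff (fun t => phi (x + t)) s v -> subdiff phi (x + s) v.
Proof.
move=> [phix [xs [vs [xs_x vs_v phixs fr]]]]; split=> //.
exists (fun k => x + xs k), vs; split=> //.
- exact: (cvgD (cvg_cst x) xs_x).
- by move=> k; exact: frechet_subdiff_translate.
Qed.

Lemma chi_translate C x s :
  chi [set t | C (x + t)] s = chi C (x + s) :> \bar R.
Proof.
have [Cs|nCs] := pselect (C (x + s)); first by rewrite !chiT.
by rewrite !chiF.
Qed.

Lemma normal_cone_translate C x w :
  normal_cone [set t | C (x + t)] 0 w -> normal_cone C x w.
Proof.
rewrite /normal_cone => Nw; rewrite -[x]addr0; apply: subdiff_translate.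
by under eq_fun do rewrite -chi_translate.
Qed.

Lemma closed_box l u : closed (box l u).
Proof.
have -> : box l u = \bigcap_i [set x | (l 0%R i <= (x 0%R i)%:E <= u 0%R i)%E].
  by apply/seteqP; split=> x Hx i; [move=> _; exact: Hx|exact: Hx].
apply: closed_bigI => i _.
have coordc : continuous (fun x : 'rV[R]_n => (x 0 i)%:E).
  move=> x; apply: (@cvg_EFin _ _ (nbhs x)); first exact: nearW.
  exact: (@coord_continuous R 1 n 0 i x).
rewrite [X in closed X](_ : _ =
    ((fun x : 'rV[R]_n => (x 0 i)%:E) @^-1` [set y | (l 0%R i <= y)%E]) `&`
    ((fun x : 'rV[R]_n => (x 0 i)%:E) @^-1` [set y | (y <= u 0%R i)%E])).
  apply: closedI; apply: preimage_closed.
  - by move=> x _; exact: coordc.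
  - exact: closed_ereal_le_ereal.
  - by move=> x _; exact: coordc.
  - exact: closed_ereal_ge_ereal.
by apply/seteqP; split=> x /= => [/andP//|[-> ->]].
Qed.

Lemma closed_translate C x : closed C -> closed [set t | C (x + t)].
Proof.
move=> clC; apply: (@preimage_closed _ _ (fun t => x + t)) => // t _.
have tt : s @[s --> t] --> t by exact: cvg_id.
exact: (cvgD (cvg_cst x) tt).
Qed.

Lemma specnorm_ge0 (B : 'M[R]_n) : 0 <= specnorm B.
Proof.
rewrite /specnorm; set E := [set _ | _ in _].
(* Without a supremum [sup] has the default value 0; otherwise the image of 0 is a member of the
   set. *)
have [Esup|/sup_out->//] := pselect (has_sup E).
have E0 : E (enorm (0 *m B^T)) by exists 0 => //=; rewrite enormE dot0l sqrtr0.
by apply: le_trans (enorm_ge0 _) (ub_le_sup Esup.2 E0).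
Qed.

Lemma m_cpE f (psi : 'rV[R]_n -> \bar R) x nu s :
  m_cp f psi x nu s =
  ((f x + dot (grad f x) s + 2^-1 * nu^-1 * dot s s)%:E + psi s)%E.
Proof. by rewrite /m_cp /varphi_cp sqr_enorm. Qed.

Lemma enorm_continuous : continuous (@enorm R n).
Proof.
have -> : @enorm R n = fun x => Num.sqrt (dot x x).
  by apply/funext => y; rewrite enormE.
move=> x; have xx : t @[t --> x] --> x by exact: cvg_id.
exact: (cvg_comp _ _ (cvg_dot xx xx) (@sqrt_continuous R (dot x x))).
Qed.

End ModelSubdifferentials.

(** * Cauchy steps and feasibility along a run *)

Section TrustRegionRun.
Context {R : realType} {n : nat}.
Variables (f : 'rV[R]_n -> R) (h : 'rV[R]_n -> \bar R) (l u : 'rV[\bar R]_n).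
Variables (psi : 'rV[R]_n -> 'rV[R]_n -> \bar R).
Variables (c : @tr_constants R) (it : @tr_iterates R n).

Lemma trial_step_Delta_ge0 k : trial_step f l u psi c it k -> 0 <= Delta_ it k.
Proof.
by move=> [_ + _]; rewrite le_min => /andP[+ _]; apply: le_trans; exact: enorm_ge0.
Qed.

Lemma nu_bound_le k : 0 < alpha c -> 0 <= Delta_ it k ->
  nu_bound c it k <= alpha c * Delta_ it k.
Proof.
move=> a0 D0; have aD : 0 <= alpha c * Delta_ it k by rewrite mulr_ge0// ltW.
rewrite /nu_bound ler_pdivrMr ?ltr_pwDl//.
  rewrite ler_peMr// lerDl mulr_ge0 ?specnorm_ge0// addr_ge0//.
by rewrite mulr_ge0 ?specnorm_ge0// addr_ge0.
Qed.

(** The step s = 0 is admissible with finite value f + h, so the minimiser has finite value as well,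
    which rules out +oo in both the model and the indicator. *)
Lemma cauchy_step_fin_num k :
  is_model h (x_ it k) (psi (x_ it k)) -> h (x_ it k) \is a fin_num ->
  box l u (x_ it k) -> 0 <= Delta_ it k ->
  cauchy_step f l u psi it k ->
  psi (x_ it k) (s1_ it k) \is a fin_num /\
  trust_region l u it k (x_ it k + s1_ it k).
Proof.
move=> [[psiNy _] _ psi0 _] hfin bx D0 /(_ 0); rewrite addr0 !m_cpE psi0.
have tr0 : trust_region l u it k (x_ it k).
  by split=> //=; rewrite subrr enormE dot0l sqrtr0.
rewrite (chiT tr0) adde0 -(fineK hfin) => le0.
have [trs|/chiF ntr] := pselect (trust_region l u it k (x_ it k + s1_ it k)).
  split=> //; move: le0 (psiNy (s1_ it k)); rewrite (chiT trs) adde0.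
  by case: (psi _ _).
by move: le0 (psiNy (s1_ it k)); rewrite ntr; case: (psi _ _).
Qed.

(** With the radius constraint strictly satisfied, the indicators of the trust region and of the box
    agree near the Cauchy step, and Fermat's rule applies to the quadratic part of [m_cp]. *)
Lemma cauchy_step_frechet_subdiff k :
  is_model h (x_ it k) (psi (x_ it k)) -> h (x_ it k) \is a fin_num ->
  box l u (x_ it k) -> enorm (s1_ it k) < Delta_ it k ->
  cauchy_step f l u psi it k ->
  frechet_subdiff (psi_hat (psi (x_ it k)) l u (x_ it k)) (s1_ it k)
    (- (grad f (x_ it k) + (nu_ it k)^-1 *: s1_ it k)).
Proof.
move=> md hfin bx sD cs.
have D0 : 0 <= Delta_ it k by rewrite (le_trans (enorm_ge0 _) (ltW sD)).
have [psifin [bs _]] := cauchy_step_fin_num md hfin bx D0 cs.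
rewrite (_ : (nu_ it k)^-1 = 2 * (2^-1 * (nu_ it k)^-1)); last first.
  by rewrite mulrA divff ?mul1r.
apply: (@frechet_subdiff_quad_localmin _ _ _ (f (x_ it k))).
  by rewrite /psi_hat fin_numD psifin chiT.
near=> s.
have sD' : enorm s <= Delta_ it k.
  by near: s; exact: (cvgr_le _ (@enorm_continuous R n (s1_ it k))).
have chiE t : enorm t <= Delta_ it k ->
    chi (trust_region l u it k) (x_ it k + t) = chi (box l u) (x_ it k + t) :> \bar R.
  move=> tD; have [bt|nbt] := pselect (box l u (x_ it k + t)).
    by rewrite !chiT//; split=> //=; rewrite addrAC subrr add0r.
  by rewrite !chiF// => -[].
by have := cs s; rewrite !m_cpE /psi_hat !chiE ?(ltW sD)// -!addeA.
Unshelve. all: by end_near. Qed.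

(** By induction. The model is finite at s_k since its value does not exceed that at the Cauchy
    step; the real bound on the gap between objective and model then makes h finite at x_k + s_k. *)
Lemma run_feasible (kappa_ubd : R) k :
  (forall x, h x \is a fin_num -> is_model h x (psi x)) ->
  tr_run f h l u psi c it ->
  (forall k, (`|objective f h (x_ it k + s_ it k)%R - m_ f psi it k (s_ it k)|
              <= (kappa_ubd * (1 + specnorm (B_ it k))
                  * enorm (s_ it k) ^+ 2)%:E)%E) ->
  box l u (x_ it k) /\ h (x_ it k) \is a fin_num.
Proof.
move=> model [_ x0 _ run] ubd; elim: k => [//|k [bx hfin]].
have [_ _ cs ts [-> _]] := run k.
case: ifP => // _; have [bs _ ms] := ts; split=> //.
have md := model _ hfin; have [psifin _] :=
  cauchy_step_fin_num md hfin bx (trial_step_Delta_ge0 ts) cs.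
have mfin : m_ f psi it k (s_ it k) \is a fin_num.
  have [[psiNy _] _ _ _] := md.
  move: ms (psiNy (s_ it k)); rewrite /m_ /m_quad -(fineK psifin).
  by case: (psi _ _).
have := ubd k; rewrite -(fineK mfin) /objective.
by case: (h _).
Qed.

End TrustRegionRun.

(** * Stationarity of the limit point *)

Theorem theorem3p13 (R : realType) (n : nat)
  (f : 'rV[R]_n -> R) (h : 'rV[R]_n -> \bar R) (l u : 'rV[\bar R]_n)
  (psi : 'rV[R]_n -> 'rV[R]_n -> \bar R)
  (c : @tr_constants R) (it : @tr_iterates R n)
  (kappa_mdc kappa_ubd mu p : R)
  (N : set nat) (xbar : 'rV[R]_n)
  (psibar : 'rV[R]_n -> \bar R) (nubar : R) :
  is_problem f h l u ->
  (forall x, h x \is a fin_num -> is_model h x (psi x)) ->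
  tr_run f h l u psi c it ->
  (forall k, nu_ it k = nu_bound c it k) ->
  0 < kappa_mdc < 1 ->
  (forall k, (kappa_mdc%:E * xi_cp f h psi it k
              <= m_ f psi it k 0%R - m_ f psi it k (s_ it k))%E) ->
  0 < kappa_ubd ->
  (forall k, (`|objective f h (x_ it k + s_ it k)%R - m_ f psi it k (s_ it k)|
              <= (kappa_ubd * (1 + specnorm (B_ it k))
                  * enorm (s_ it k) ^+ 2)%:E)%E) ->
  0 < mu -> 0 < p < 1 ->
  (forall k, \big[Num.max/0]_(j < k.+1) specnorm (B_ it j)
             <= mu * (1 + (num_successful f h psi c it k)%:R `^ p)) ->
  infinite_set [set k | successful f h psi c it k] ->
  (\forall eps \near 0^'+,
     ((mu + 1)%:E <= mu%:E * counting (S_eps f h psi c it eps) `^ p)%E) ->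
  (exists b : R, forall k, (b%:E <= objective f h (x_ it k))%E) ->
  infinite_set N ->
  crit_measure f h psi it k @[k --> within N \oo] --> 0 ->
  (nu_ it k)^-1 *: s1_ it k @[k --> within N \oo] --> (0 : 'rV[R]_n) ->
  s1_ it k @[k --> within N \oo] --> (0 : 'rV[R]_n) ->
  s_ it k @[k --> within N \oo] --> (0 : 'rV[R]_n) ->
  x_ it k @[k --> within N \oo] --> xbar ->
  box l u xbar ->
  is_model h xbar psibar ->
  limsup_sets N (fun k => subdiff (psi_hat (psi (x_ it k)) l u (x_ it k)) (s1_ it k))
    `<=` subdiff (psi_hat psibar l u xbar) 0 ->
  0 < nubar ->
  constraint_qualification (m_cp f psibar xbar nubar)
    [set s | box l u (xbar + s)] 0 ->
  constraint_qualification (objective f h) (box l u) xbar ->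
  stationary f h l u xbar.
Proof.
move=> prob model run nuE _ _ _ ubd _ _ _ _ _ _ infN _ nus1 _ _ xN bxbar
  [[psibarNy _] lpsibar psibar0 psibar_sub] limsup_sub _ [_ cq] _.
have feas k := run_feasible k model run ubd.
have [[_ _ _ _ [alpha0 _]] _ _ step] := run.
have [_ [U [oU boxU fdiff]] _ _] := prob.
have gradN : grad f (x_ it k) @[k --> within N \oo] --> grad f xbar.
  exact: (cvg_comp _ _ xN (fdiff _ (boxU _ bxbar)).2).
pose y k := - (grad f (x_ it k) + (nu_ it k)^-1 *: s1_ it k).
have yN : y k @[k --> within N \oo] --> - grad f xbar.
  by rewrite -[grad f xbar]addr0; exact: (cvgN (cvgD gradN nus1)).
(* Below this threshold, enorm s1 <= (n + 1) |s1| < nu / alpha <= Delta, so the radius constraint is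
   inactive. *)
have e0 : 0 < (n.+1%:R * alpha c)^-1 by rewrite invr_gt0 mulr_gt0.
have [K0 _ K0P] := cvgr_dist_lt _ _ nus1 _ e0.
have inactive k : (K0 <= k)%N -> N k -> enorm (s1_ it k) < Delta_ it k.
  move=> K0k Nk; have := K0P k K0k Nk; rewrite sub0r normrN.
  have [_ /andP[nu0 _] _ ts _] := step k.
  rewrite normrZ gtr0_norm ?invr_gt0// ltr_pdivrMl// ltr_pdivlMr ?mulr_gt0//.
  move=> s1nu; have D0 := trial_step_Delta_ge0 ts.
  have := nu_bound_le alpha0 D0; rewrite -nuE => nuD.
  rewrite -(ltr_pM2l alpha0) (lt_le_trans _ nuD)// (le_lt_trans _ s1nu)//.
  rewrite mulrC [leRHS]mulrC -mulrA (mulrC (alpha c)) mulrA.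
  by rewrite ler_wpM2r ?(ltW alpha0)// enorm_le_norm.
(* The outer limit requires a subgradient at every index of K, so the finitely many indices with a
   possibly active radius are discarded. *)
pose K := N `\` `I_K0.
have /limsup_sub ylim : limsup_sets N (fun k =>
    subdiff (psi_hat (psi (x_ it k)) l u (x_ it k)) (s1_ it k)) (- grad f xbar).
  exists K, y; split.
  - by move=> k [].
  - exact: infinite_setD infN (finite_II K0).
  - move=> k [Nk /negP]; rewrite -leqNgt => K0k.
    have [bx hfin] := feas k; have [_ _ cs _ _] := step k.
    apply: frechet_subdiff_subset; apply: (cauchy_step_frechet_subdiff (h := h)) => //.
      exact: model.
    exact: inactive.
  - apply: cvg_trans yN; apply: cvg_app; apply: within_subset; by move=> k [].
pose C := [set s | box l u (xbar + s)].
have clC : closed C by apply: closed_translate; exact: closed_box.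
set q := m_cp f psibar xbar nubar in cq *.
have qE : q = fun s => ((f xbar + dot (grad f xbar) s
    + 2^-1 * nubar^-1 * dot s s)%:E + psibar s)%E.
  by apply/funext => s; rewrite /q m_cpE.
(* Adding the smooth part of [m_cp] contributes exactly grad f xbar, since the proximal term has
   zero gradient at s = 0; this cancels the limit - grad f xbar. *)
have sub0 : subdiff (fun s => q s + chi C s)%E 0 0.
  have := subdiff_quadD (f xbar) (grad f xbar) (2^-1 * nubar^-1) ylim.
  rewrite scaler0 addr0 subrr; congr (subdiff _ 0 0); apply/funext => s.
  by rewrite qE /psi_hat chi_translate addeA.
have lq : lower_semicontinuous q.
  by rewrite qE; apply: lower_semicontinuousD => //; exact: quad_continuous.
have qNy s : q s != -oo%E.
  by rewrite qE; have := psibarNy s; case: (psibar s).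
have cq' w : horizon_subdiff q 0 w -> normal_cone C 0 (- w) -> w = 0.
  move=> hw Nw; have : [set (0 : 'rV[R]_n)] w; last by [].
  by rewrite -cq; split=> //; exists (- w) => //; rewrite opprK.
have [v [w [vq wN vw]]] := subdiff_sum_rule lq qNy clC cq' sub0.
(* Subtracting the smooth part of [q] turns v into a subgradient of [psibar] at 0, hence of h at
   xbar. *)
exists (v - grad f xbar), w; split.
- apply: psibar_sub.
  have := subdiff_quadD (- f xbar) (- grad f xbar) (- (2^-1 * nubar^-1)) vq.
  rewrite scaler0 addr0 addrC; congr (subdiff _ 0 _); apply/funext => s.
  rewrite qE addeA -EFinD dotNl mulNr -!opprD addNr.
  by rewrite add0e.
- exact: normal_cone_translate.
- by rewrite subrKC.
Qed.
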